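(* Let $n\ge1$, let $a$ be a nonzero real polynomial of degree at most $n$, let $b$ be a nonzero real polynomial of degree at most $n-1$, and let $p(x)=\frac{1}{|a(x)|}\exp\big(\frac{2}{n}\int\frac{b(x)}{a(x)}dx\big)$ be the associated weight function. Let $r$ be a real zero of $a$, let $\alpha=m_a(r)$ and $\beta=m_b(r)$ be the multiplicities of $r$ as a root of $a$ and of $b$, and write $\frac{b(x)}{a(x)}=(x-r)^{\beta-\alpha}\phi(x)$, where $\phi$ is a rational function with $\phi(r)=\lim_{x\to r}(x-r)^{\alpha-\beta}\frac{b(x)}{a(x)}\neq 0$. Then: (i) If $r$ is an ordinary root of $a$, then $p$ is integrable from the right at $r$ if and only if $\alpha-\beta\ge 2$ and $\phi(r)>0$; and $p$ is integrable from the left at $r$ if and only if $\alpha-\beta\ge2$ and $(-1)^{\alpha-\beta}\phi(r)<0$. In this case $p$ is, respectively, right/left $C^\infty$ differentiable at $r$, and $p$ and all its one-sided derivatives vanish at $r$. (ii) If $r$ is a logarithmic root of $a$, then $p$ is right (respectively left) integrable near $r$ if and only if $\frac{|x-r|^{\frac2n\phi(r)}}{|x-r|^{\alpha}}$ is integrable near $r$, if and only if $\frac{2}{n}\phi(r)-\alpha+1>0$.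
   Context: The weight is defined piecewise: on each open interval $J$ containing no zeros of $a$, after choosing a base point $p_0\in J$, $p(x)=\frac{1}{|a(x)|}\exp\big(\frac2n\int_{p_0}^x\frac{b(t)}{a(t)}dt\big)$. A root $r$ of $a$ is called ordinary if $m_b(r)-m_a(r)+1\ne0$, and logarithmic if $m_b(r)-m_a(r)+1=0$ (with $m_b(r)=0$ if $b(r)\neq0$). $p$ is integrable from the right at $r$ if, for $p$ on an interval $(r,r+\delta)$ free of zeros of $a$ and any $\eta$ in it, $\lim_{\epsilon\to0^+}\int_{r+\epsilon}^{\eta}p(x)\,dx$ exists (finite); integrable from the left at $r$ is the analogous condition on an interval $(r-\delta,r)$ ending at $r$. In the differentiability statement, $p$ is given the value $0$ at $r$ on the side considered. *)

(* Defs.v *)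
From HB Require Import structures.
From mathcomp Require Import all_boot all_order all_algebra.
From mathcomp Require Import all_classical all_reals all_analysis.
Set Implicit Arguments.
Unset Strict Implicit.
Unset Printing Implicit Defensive.
Import Order.TTheory GRing.Theory Num.Theory.
Import numFieldNormedType.Exports.
Local Open Scope classical_set_scope.
Local Open Scope ring_scope.

Definition oriented_integral (R : realType) (f : R -> R) (u v : R) : R :=
  if u <= v then \int[lebesgue_measure]_(t in `[u, v]) f t
  else - \int[lebesgue_measure]_(t in `[v, u]) f t.

Definition zero_free (R : realType) (a : {poly R}) (u v : R) : Prop :=
  forall x : R, x \in `]u, v[ -> a.[x] != 0.

(* Meaningful only at points [x] of an open interval that contains [p0] and no
   zero of [a]. *)
Definition weight (R : realType) (n : nat) (a b : {poly R}) (p0 x : R) : R :=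
  `|a.[x]|^-1 *
  expR (2 / n%:R * oriented_integral (fun t => b.[t] / a.[t]) p0 x).

(* [p] is only looked at on ]r, u[, where it is supposed continuous. *)
Definition integrable_from_right (R : realType) (p : R -> R) (r u : R) : Prop :=
  forall eta : R, eta \in `]r, u[ ->
    cvg ((\int[lebesgue_measure]_(x in `[r + e, eta]) p x) @[e --> 0^'+]).

Definition integrable_from_left (R : realType) (p : R -> R) (r u : R) : Prop :=
  forall eta : R, eta \in `]u, r[ ->
    cvg ((\int[lebesgue_measure]_(x in `[eta, r - e]) p x) @[e --> 0^'+]).

Definition ordinary_root (R : realType) (a b : {poly R}) (r : R) : Prop :=
  root a r /\ (mup r b)%:Z - (mup r a)%:Z + 1 <> 0.

Definition logarithmic_root (R : realType) (a b : {poly R}) (r : R) : Prop :=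
  root a r /\ (mup r b)%:Z - (mup r a)%:Z + 1 = 0.

(* The rational function phi such that b / a = (x - r) ^ (beta - alpha) * phi,
   in a form which is defined at [r]: each factor ('X - r) has been removed from
   the numerator and from the denominator. *)
Definition cofactor (R : realType) (q : {poly R}) (r : R) : {poly R} :=
  q %/ ('X - r%:P) ^+ mup r q.

Definition phi (R : realType) (a b : {poly R}) (r x : R) : R :=
  (cofactor b r).[x] / (cofactor a r).[x].

Definition set_zero_at (R : realType) (p : R -> R) (r x : R) : R :=
  if x == r then 0 else p x.

Definition diff_quotient (R : realType) (f : R -> R) (x h : R) : R :=
  h^-1 * (f (x + h) - f x).

Definition right_derivable (R : realType) (f : R -> R) (x : R) : Prop :=
  cvg (diff_quotient f x h @[h --> 0^'+]).

Definition left_derivable (R : realType) (f : R -> R) (x : R) : Prop :=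
  cvg (diff_quotient f x h @[h --> 0^'-]).

Definition right_derive (R : realType) (f : R -> R) (x : R) : R :=
  lim (diff_quotient f x h @[h --> 0^'+]).

Definition left_derive (R : realType) (f : R -> R) (x : R) : R :=
  lim (diff_quotient f x h @[h --> 0^'-]).

Definition right_derive_n (R : realType) (k : nat) (f : R -> R) : R -> R :=
  iter k (@right_derive R) f.

Definition left_derive_n (R : realType) (k : nat) (f : R -> R) : R -> R :=
  iter k (@left_derive R) f.

(* f is C^oo on some [r, r + d[, with one-sided derivatives at r. On ]r, r + d[
   the one-sided derivatives are the usual ones, by two-sided derivability; the
   continuity of all the derivatives on [r, r + d[ follows from their
   differentiability. *)
Definition right_smooth (R : realType) (f : R -> R) (r : R) : Prop :=
  exists2 d : R, 0 < d &
    forall k : nat, right_derivable (right_derive_n k f) r /\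
      (forall x : R, x \in `]r, r + d[ -> derivable (right_derive_n k f) x 1).

Definition left_smooth (R : realType) (f : R -> R) (r : R) : Prop :=
  exists2 d : R, 0 < d &
    forall k : nat, left_derivable (left_derive_n k f) r /\
      (forall x : R, x \in `]r - d, r[ -> derivable (left_derive_n k f) x 1).

(* Main.v *)
Require Import Defs.
From HB Require Import structures.
From mathcomp Require Import all_boot all_order all_algebra.
From mathcomp Require Import all_classical all_reals all_analysis.
From mathcomp Require Import ring lra zify.
Set Implicit Arguments.
Unset Strict Implicit.
Unset Printing Implicit Defensive.
Import Order.TTheory GRing.Theory Num.Theory.
Import numFieldNormedType.Exports.
Local Open Scope classical_set_scope.
Local Open Scope ring_scope.

(** Measure the distance to the root by t > 0, on the side considered. There the
exponent L of the weight satisfies L' = t ^ (- m) * phi, with m = alpha - beta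
and phi tending to a nonzero limit phi0, namely phi(r) up to a sign which
depends on the side and on the parity of m; and the weight is
g = exp(c L) / (t ^ alpha w), with c = 2 / n and w tending to a positive limit.
Everything follows from comparing L' with simpler derivatives.

- If m <= 0 or phi0 < 0, then L' is bounded above, so L is bounded below as t
  tends to 0, and g is at least a constant times 1 / t because alpha >= 1: the
  integral diverges (singular_weight_diverges).
- If m >= 2 and phi0 > 0, then L' is at least k / t ^ 2 for some k > 0, so
  exp(c L) is at most a constant times exp(- c k / t). Hence g is smaller than
  every power of t (singular_weight_flat) and the integral converges.
- If m = 1, then L' - phi0 / t is bounded because phi is Lipschitz at the root.
  So L - phi0 ln t is bounded and g lies between two positive multiples of
  t ^ (c phi0 - alpha) (singular_weight_power), whose integral converges exactly
  when the exponent exceeds - 1.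

As the weights are positive and continuous, their improper integrals are handled
through primitives: convergence is the existence of a limit of a primitive at
the root (integrable_from_rightP, integrable_from_leftP), and a primitive of a
nonnegative function is monotone, so that it converges once it is bounded
(is_cvg_primitive_comparison).

For smoothness, the k-th derivative of p away from r is p * N_k / a ^ k for a
polynomial N_k (is_derive_weight_derivative). When p is smaller than every power
of |x - r|, so are all these functions, so their difference quotients at r tend
to 0 and an induction on k computes all the one-sided derivatives
(iter_side_derive). The two sides are treated together, along the ray
t |-> r + sigma t with sigma = 1 or sigma = -1. *)

(** * Primitives and improper integrals *)

Section primitives.
Context {R : realType}.
Implicit Types (f F : R -> R) (u v c d : R).

Definition primitive_on u v F f :=
  forall x : R, x \in `]u, v[ -> is_derive x 1 F (f x).

Lemma is_derive_continuous F (x df : R) :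
  is_derive x 1 F df -> {for x, continuous F}.
Proof.
by move=> [dF _]; apply/differentiable_continuous/derivable1_diffP.
Qed.

Lemma subinterval_continuous f u v c d :
  {in `]u, v[, continuous f} -> u < c -> d < v ->
  {within `[c, d], continuous f}.
Proof.
move=> cf uc dv; apply: continuous_subspace_itv => x /[!in_itv]/= /andP[cx xd].
by apply: cf; rewrite in_itv/= (lt_le_trans uc)//= (le_lt_trans xd).
Qed.

Lemma subinterval_integrable f u v c d :
  {in `]u, v[, continuous f} -> u < c -> d < v ->
  lebesgue_measure.-integrable `[c, d] (EFin \o f).
Proof.
move=> cf uc dv; apply: continuous_compact_integrable.
  exact: segment_compact.
exact: subinterval_continuous cf uc dv.
Qed.

Lemma Rintegral_primitive f F u v c d :
  {in `]u, v[, continuous f} -> primitive_on u v F f ->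
  u < c -> c <= d -> d < v ->
  \int[lebesgue_measure]_(x in `[c, d]) f x = F d - F c.
Proof.
move=> cf dF uc + dv; rewrite le_eqVlt => /predU1P[->|cd].
  by rewrite set_itv1 Rintegral_set1 subrr.
have in_uv x : c <= x -> x <= d -> x \in `]u, v[.
  by move=> cx xd; rewrite in_itv/= (lt_le_trans uc)//= (le_lt_trans xd).
have cF x : x \in `]u, v[ -> {for x, continuous F}.
  by move=> /dF /is_derive_continuous.
rewrite /Rintegral (@continuous_FTC2 _ f F)//.
- exact: subinterval_continuous cf uc dv.
- split.
  + move=> x /[!in_itv]/= /andP[cx xd].
    by have [] := dF x (in_uv _ (ltW cx) (ltW xd)).
  + by apply: cvg_at_right_filter; apply: cF; apply: in_uv => //; exact: ltW.
  + by apply: cvg_at_left_filter; apply: cF; apply: in_uv => //; exact: ltW.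
- move=> x /[!in_itv]/= /andP[cx xd]; rewrite derive1E.
  by have [_ ->] := dF x (in_uv _ (ltW cx) (ltW xd)).
Qed.

(** Fixing a lower bound c smaller than both p0 and x turns the oriented integral
into a difference of two integrals over segments which start at c, whatever the
position of x with respect to p0, so the fundamental theorem applies. *)
Lemma is_derive_oriented_integral f u v p0 :
  {in `]u, v[, continuous f} -> p0 \in `]u, v[ ->
  primitive_on u v (oriented_integral f p0) f.
Proof.
move=> cf /[!in_itv]/= /andP[up0 p0v] x /[!in_itv]/= /andP[ux xv].
pose c := (u + Num.min p0 x) / 2; pose d := (v + x) / 2.
have um : u < Num.min p0 x by rewrite lt_min up0.
have uc : u < c by rewrite /c; lra.
have cm : c < Num.min p0 x by rewrite /c; lra.
have /andP[cp0 cx] : (c < p0) && (c < x) by rewrite -lt_min.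
have xd : x < d by rewrite /d; lra.
have dv : d < v by rewrite /d; lra.
pose G (y : R) := \int[lebesgue_measure]_(t in `[c, y]) f t.
have GB y z : c <= y -> y <= z -> z < v ->
    \int[lebesgue_measure]_(t in `[y, z]) f t = G z - G y.
  move=> cy yz zv; rewrite /G Rintegral_itvB//; last first.
    exact: subinterval_integrable cf uc zv.
  rewrite -Rintegral_itv_obnd_cbnd//.
  apply: integrableS (subinterval_integrable cf uc zv) => //.
  by apply: subset_itv; rewrite bnd_simp.
have fx : {for x, continuous f} by apply: cf; rewrite in_itv/= ux.
have fcd := subinterval_integrable cf uc dv.
have [dG G'] := continuous_FTC1_closed xd fcd cx fx.
have eqF : \near x, G x - G p0 = oriented_integral f p0 x.
  near=> y.
  have cy : c < y by near: y; exact: lt_nbhsr.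
  have yv : y < v by near: y; exact: lt_nbhsl.
  rewrite /oriented_integral; case: ifPn => [p0y|]; first by rewrite GB// ltW.
  by rewrite -ltNge => yp0; rewrite GB ?opprB// ltW.
apply: near_eq_is_derive eqF _.
have dG' : is_derive x 1 G (f x) by apply: DeriveDef; rewrite -?derive1E.
by apply: is_derive_eq; rewrite subr0.
Unshelve. all: by end_near. Qed.

Lemma near_eq_is_cvg (T : Type) (G : set_system T) (f g : T -> R) :
  Filter G -> {near G, f =1 g} -> cvg (f @ G) -> cvg (g @ G).
Proof.
move=> FG fg cf; apply: cvgP (cvg_trans _ cf).
exact: near_eq_cvg.
Qed.

Lemma is_cvg_subl (T : Type) (G : set_system T) (k : R) (f : T -> R) :
  Filter G -> cvg (k - f e @[e --> G]) <-> cvg (f @ G).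
Proof.
move=> FG; split=> [ckf|cf]; last exact: is_cvgB (is_cvg_cst k) cf.
apply: near_eq_is_cvg (is_cvgB (is_cvg_cst k) ckf).
by apply: nearW => e /=; rewrite subKr.
Qed.

Lemma is_cvg_subr (T : Type) (G : set_system T) (k : R) (f : T -> R) :
  Filter G -> cvg (f e - k @[e --> G]) <-> cvg (f @ G).
Proof.
move=> FG; split=> [ckf|cf]; last exact: is_cvgB cf (is_cvg_cst k).
apply: near_eq_is_cvg (is_cvgD ckf (is_cvg_cst k)).
by apply: nearW => e /=; rewrite subrK.
Qed.

(** The integral over [r + e, eta] is F eta - F (r + e), so moving the
endpoint eta only adds a constant. *)
Lemma integrable_from_rightP f F (r u : R) : r < u ->
  {in `]r, u[, continuous f} -> primitive_on r u F f ->
  integrable_from_right f r u <-> cvg (F (r + e) @[e --> 0^'+]).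
Proof.
move=> ru cf dF.
have intE eta : eta \in `]r, u[ -> {near 0^'+, forall e,
    \int[lebesgue_measure]_(x in `[r + e, eta]) f x = F eta - F (r + e)}.
  move=> /[!in_itv]/= /andP[reta etau]; near=> e.
  have e0 : 0 < e by near: e; exact: nbhs_right_gt.
  have eeta : e < eta - r by near: e; apply: nbhs_right_lt; rewrite subr_gt0.
  by rewrite (Rintegral_primitive cf dF)//; lra.
split=> [cI|cF eta etaI].
  have mI : (r + u) / 2 \in `]r, u[ by rewrite in_itv/=; apply/andP; split; lra.
  apply/(is_cvg_subl (F ((r + u) / 2))).
  by apply: near_eq_is_cvg (cI _ mI); exact: intE.
have cFeta : cvg (F eta - F (r + e) @[e --> 0^'+]) by apply/is_cvg_subl.
apply: near_eq_is_cvg cFeta.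
by have := intE _ etaI; apply: filterS => e ->.
Unshelve. all: by end_near. Qed.

Lemma integrable_from_leftP f F (r u : R) : u < r ->
  {in `]u, r[, continuous f} -> primitive_on u r F f ->
  integrable_from_left f r u <-> cvg (F (r - e) @[e --> 0^'+]).
Proof.
move=> ur cf dF.
have intE eta : eta \in `]u, r[ -> {near 0^'+, forall e,
    \int[lebesgue_measure]_(x in `[eta, r - e]) f x = F (r - e) - F eta}.
  move=> /[!in_itv]/= /andP[ueta etar]; near=> e.
  have e0 : 0 < e by near: e; exact: nbhs_right_gt.
  have eeta : e < r - eta by near: e; apply: nbhs_right_lt; rewrite subr_gt0.
  by rewrite (Rintegral_primitive cf dF)//; lra.
split=> [cI|cF eta etaI].
  have mI : (u + r) / 2 \in `]u, r[ by rewrite in_itv/=; apply/andP; split; lra.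
  apply/(is_cvg_subr (F ((u + r) / 2))).
  by apply: near_eq_is_cvg (cI _ mI); exact: intE.
have cFeta : cvg (F (r - e) - F eta @[e --> 0^'+]) by apply/is_cvg_subr.
apply: near_eq_is_cvg cFeta.
by have := intE _ etaI; apply: filterS => e ->.
Unshelve. all: by end_near. Qed.

End primitives.

(** * Comparison of primitives near the left end of an interval *)

Section behaviour_at_zero.
Context {R : realType}.
Implicit Types (f g h F G H : R -> R) (T : R).

Lemma near_at_right0P (P : R -> Prop) :
  (\forall t \near 0^'+, P t) <->
  (exists2 d : R, 0 < d & forall t, 0 < t -> t < d -> P t).
Proof.
split=> [[d /= d0 dP]|[d d0 dP]].
  exists d => // t t0 td; apply: dP => //=.
  by rewrite sub0r normrN gtr0_norm.
near=> t; apply: dP; first by near: t; exact: nbhs_right_gt.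
by near: t; exact: nbhs_right_lt.
Unshelve. all: by end_near. Qed.

Lemma ge0_primitive_ndecr F f T : primitive_on 0 T F f ->
  (forall t, 0 < t -> t < T -> 0 <= f t) ->
  forall x y, 0 < x -> x <= y -> y < T -> F x <= F y.
Proof.
move=> dF f0 x y x0 xy yT.
have inT z : x <= z -> z <= y -> z \in `]0, T[.
  by move=> xz zy; rewrite in_itv/= (lt_le_trans x0)//= (le_lt_trans zy).
have [||c cxy Fxy] := @MVT_segment _ F f x y xy.
- by move=> z /[!in_itv]/= /andP[xz zy]; apply/dF/inT; exact: ltW.
- apply: continuous_subspace_itv => z /[!in_itv]/= /andP[xz zy].
  exact: is_derive_continuous (dF _ (inT _ xz zy)).
move: cxy; rewrite in_itv/= => /andP[xc cy].
rewrite -subr_ge0 Fxy mulr_ge0 ?subr_ge0// f0//; last exact: le_lt_trans yT.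
exact: lt_le_trans xc.
Qed.

(** Integrating down to 0 reverses the comparison: when G grows faster than F,
G - F is nondecreasing, hence bounded above near 0. *)
Lemma primitive_near_le F f G g T : 0 < T ->
  primitive_on 0 T F f -> primitive_on 0 T G g ->
  (\forall t \near 0^'+, f t <= g t) ->
  exists D, \forall t \near 0^'+, G t <= F t + D.
Proof.
move=> T0 dF dG /near_at_right0P[d d0 fg].
pose s := Num.min d T.
have s0 : 0 < s by rewrite lt_min d0.
have [sd sT] : s <= d /\ s <= T by rewrite /s; split; rewrite ge_min lexx ?orbT.
have dGF : primitive_on 0 s (G \- F) (g \- f).
  move=> t /[!in_itv]/= /andP[t0 ts].
  have tT : t \in `]0, T[ by rewrite in_itv/= t0 (lt_le_trans ts).
  have ? := dF _ tT; have ? := dG _ tT.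
  exact: is_deriveB.
exists (G (s / 2) - F (s / 2)); apply/near_at_right0P; exists (s / 2); first lra.
move=> t t0 ts.
have : (G \- F) t <= (G \- F) (s / 2).
  apply: (ge0_primitive_ndecr dGF) => //; [|exact: ltW|lra].
  by move=> z z0 zs; rewrite /= subr_ge0 fg// (lt_le_trans zs).
by rewrite /=; lra.
Qed.

Lemma is_cvg_near_bounded f : cvg (f @ 0^'+) ->
  exists M, \forall t \near 0^'+, `|f t| <= M.
Proof.
move=> cf; exists (`|lim (f @ 0^'+)| + 1).
by apply: (cvgr_norm_le _ cf); rewrite ltrDl.
Qed.

(** H is nondecreasing near 0, and C * G - H is bounded above there, so H inherits
a lower bound from G. *)
Lemma is_cvg_primitive_comparison g G h H (C T : R) : 0 < T ->
  primitive_on 0 T G g -> primitive_on 0 T H h ->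
  (\forall t \near 0^'+, 0 <= h t <= C * g t) ->
  cvg (G @ 0^'+) -> cvg (H @ 0^'+).
Proof.
move=> T0 dG dH hg cG.
have [M GM] := is_cvg_near_bounded cG.
have dCG : primitive_on 0 T (fun t => C * G t) (fun t => C * g t).
  by move=> t /dG ?; apply: is_deriveZ.
have [D HD] : exists D, \forall t \near 0^'+, C * G t <= H t + D.
  by apply: (primitive_near_le T0 dH dCG); apply: filterS hg => t /andP[].
have /near_at_right0P[d d0 Hd] : \forall t \near 0^'+,
    0 <= h t /\ - (`|C| * M + D) <= H t.
  near=> t; split.
    by suff /andP[] : 0 <= h t <= C * g t by []; near: t.
  have Gt : `|G t| <= M by near: t.
  have Ht : C * G t <= H t + D by near: t.
  have := ler_norm (- (C * G t)); rewrite normrN normrM => CG.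
  have := ler_wpM2l (normr_ge0 C) Gt; lra.
have monoH x : x <= d -> x <= T -> {in `]0, x[ &, nondecreasing_fun H}.
  move=> xd xT y z /[!in_itv]/= /andP[y0 _] /andP[_ zx] yz.
  have dHx : primitive_on 0 x H h.
    move=> t /[!in_itv]/= /andP[t0 tx]; apply: dH.
    by rewrite in_itv/= t0 (lt_le_trans tx).
  apply: (ge0_primitive_ndecr dHx) => // t t0 tx.
  by have [] := Hd t t0 (lt_le_trans tx xd).
apply: nondecreasing_at_right_is_cvgr.
  near=> x; apply: monoH.
    by near: x; exact: nbhs_right_le.
  by near: x; exact: nbhs_right_le.
near=> x; exists (- (`|C| * M + D)) => _ [t /= + <-].
rewrite in_itv/= => /andP[t0 tx].
have td : t < d.
  by rewrite (lt_trans tx)//; near: x; exact: nbhs_right_lt.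
by have [_] := Hd t t0 td.
Unshelve. all: by end_near. Qed.

Lemma not_is_cvg_ln : ~ cvg (@ln R x @[x --> 0^'+]).
Proof.
move=> /is_cvg_near_bounded[M lnM].
near (0 : R)^'+ => t.
have : `|ln t| <= M by near: t.
have : ln t < - M by near: t; exact: (cvgrNy_lt (@lnNy R)).
rewrite ler_norml => ? /andP[? _]; lra.
Unshelve. all: by end_near. Qed.

Lemma primitive_ln T : primitive_on 0 T (@ln R) (fun t => t^-1).
Proof. by move=> t /[!in_itv]/= /andP[t0 _]; exact: is_derive1_ln. Qed.

Lemma primitive_above_inv_diverges g G (k T : R) : 0 < T -> 0 < k ->
  primitive_on 0 T G g -> (\forall t \near 0^'+, k * t^-1 <= g t) ->
  ~ cvg (G @ 0^'+).
Proof.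
move=> T0 k0 dG kg cG; apply: not_is_cvg_ln.
apply: (is_cvg_primitive_comparison (C := k^-1) T0 dG (@primitive_ln T) _ cG).
near=> t.
have t0 : 0 < t by near: t; exact: nbhs_right_gt.
rewrite invr_ge0 (ltW t0)/= mulrC ler_pdivlMr// mulrC.
by near: t.
Unshelve. all: by end_near. Qed.

Lemma primitive_bounded_is_cvg g G (C T : R) : 0 < T ->
  primitive_on 0 T G g -> (\forall t \near 0^'+, 0 <= g t <= C) ->
  cvg (G @ 0^'+).
Proof.
move=> T0 dG gC.
have did : primitive_on 0 T id (fun=> 1) by move=> t _; exact: is_derive_id.
apply: (is_cvg_primitive_comparison (C := C) T0 did dG).
  by under eq_near do rewrite mulr1.
by apply: cvgP (cvg_at_right_filter _); exact: cvg_id.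
Qed.

(** For s + 1 <= 0, the integrand is at least 1 / t below 1, which also covers the
exponent s = - 1, where the primitive is not a power. *)
Lemma primitive_powR_is_cvgP H (s T : R) : 0 < T ->
  primitive_on 0 T H (fun t => t `^ s) ->
  cvg (H @ 0^'+) <-> 0 < s + 1.
Proof.
move=> T0 dH; split=> [cH|s1].
  rewrite ltNge; apply/negP => s1.
  apply: (primitive_above_inv_diverges T0 ltr01 dH _ cH); near=> t.
  have t0 : 0 < t by near: t; exact: nbhs_right_gt.
  have t1 : t <= 1 by near: t; exact: nbhs_right_le.
  rewrite mul1r -(powR_inv1 (ltW t0)); apply: ger_powR; first by rewrite t0.
  by rewrite -lerBrDr sub0r in s1.
have dP : primitive_on 0 T (fun t => (s + 1)^-1 * t `^ (s + 1))
    (fun t => t `^ s).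
  move=> t /[!in_itv]/= /andP[t0 _].
  apply: is_derive_eq (is_deriveZ _ (is_derive1_powR (s + 1) t0)) _.
  by rewrite addrK /GRing.scale/= mulKf// gt_eqF.
apply: (is_cvg_primitive_comparison (C := 1) T0 dP dH).
  by near=> t; rewrite mul1r lexx powR_ge0.
apply: is_cvgM; first exact: is_cvg_cst.
exact: cvgP (powR_cvg0 s1).
Unshelve. all: by end_near. Qed.

End behaviour_at_zero.

(** * Weights with an exponential singularity *)

Section exponential_singularity.
Context {R : realType}.

(** The situation on either side of a root of multiplicity alpha, in terms of the
distance t to it: g is the weight, G a primitive of g, L the integral of b / a,
m the order of the pole of b / a, and w and phi what remains of |a| and of b / a
once the powers of t have been removed. *)
Record exp_singularity (c T w0 phi0 : R) (alpha : nat) (m : int)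
    (w phi L g G : R -> R) : Prop := ExpSingularity {
  sing_coef_gt0 : 0 < c;
  sing_length_gt0 : 0 < T;
  sing_order_gt0 : (0 < alpha)%N;
  sing_denominator_gt0 : 0 < w0;
  sing_denominator_cvg : w t @[t --> 0^'+] --> w0;
  sing_exponent_cvg : phi t @[t --> 0^'+] --> phi0;
  sing_exponent_primitive : primitive_on 0 T L (fun t => t ^ (- m) * phi t);
  sing_weightE : \forall t \near 0^'+,
    g t = expR (c * L t) / (t ^+ alpha * w t);
  sing_weight_primitive : primitive_on 0 T G g }.

Lemma singular_weight_bounds (c T w0 phi0 : R) alpha m
    (w phi L g G : R -> R) :
  exp_singularity c T w0 phi0 alpha m w phi L g G ->
  \forall t \near 0^'+,
  expR (c * L t) / t ^+ alpha * (2 * w0)^-1 <= g t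
    <= expR (c * L t) / t ^+ alpha * (2 / w0).
Proof.
move=> [c_gt0 T_gt0 alpha_gt0 w0_gt0 w_cvg phi_cvg dL gE dG].
have w0_half : w0 / 2 < w0 by lra.
have w0_double : w0 < 2 * w0 by lra.
near=> t.
have t0 : 0 < t by near: t; exact: nbhs_right_gt.
have -> : g t = expR (c * L t) / t ^+ alpha * (w t)^-1.
  by rewrite -mulrA -invfM; near: t.
have wlo : w0 / 2 <= w t by near: t; exact: (cvgr_ge _ w_cvg _ w0_half).
have whi : w t <= 2 * w0 by near: t; exact: (cvgr_le _ w_cvg _ w0_double).
have wt0 : 0 < w t by lra.
have e0 : 0 <= expR (c * L t) / t ^+ alpha.
  by rewrite divr_ge0 ?expR_ge0// exprn_ge0// ltW.
rewrite !ler_wpM2l//.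
  by rewrite -[leRHS]invrK lef_pV2 ?posrE ?invr_gt0 ?invf_div// divr_gt0.
by rewrite lef_pV2 ?posrE// mulr_gt0.
Unshelve. all: by end_near. Qed.

Lemma exprn_le_id (alpha : nat) (t : R) :
  (0 < alpha)%N -> 0 < t -> t <= 1 -> t ^+ alpha <= t.
Proof.
case: alpha => // k _ t0 t1.
by rewrite exprS ler_piMr ?(ltW t0)// exprn_ile1 ?(ltW t0).
Qed.

(** In both cases the derivative of the exponent is bounded above by some K >= 0,
so the exponent does not tend to minus infinity at 0. *)
Lemma singular_weight_diverges (c T w0 phi0 : R) alpha m
    (w phi L g G : R -> R) :
  exp_singularity c T w0 phi0 alpha m w phi L g G ->
  m <= 0 \/ phi0 < 0 -> ~ cvg (G @ 0^'+).
Proof.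
move=> sing mphi.
have [c_gt0 T_gt0 alpha_gt0 w0_gt0 w_cvg phi_cvg dL gE dG] := sing.
have [K K0 LK] : exists2 K, 0 <= K &
    \forall t \near 0^'+, t ^ (- m) * phi t <= K.
  case: mphi => [m0|phi0_lt0].
    exists (`|phi0| + 1); first by rewrite addr_ge0.
    near=> t.
    have t0 : 0 < t by near: t; exact: nbhs_right_gt.
    have t1 : t <= 1 by near: t; exact: nbhs_right_le.
    have phit : `|phi t| <= `|phi0| + 1.
      by near: t; apply: (cvgr_norm_le _ phi_cvg); rewrite ltrDl.
    apply: le_trans (ler_norm _) _; rewrite normrM.
    rewrite (ger0_norm (exprz_ge0 _ (ltW t0))) -[leRHS]mul1r ler_pM//.
      exact/exprz_ge0/ltW.
    have := @ler_wpiXz2l _ t (ltW t0) t1 (- m) 0; rewrite expr0z; apply.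
    - by rewrite -topredE/= ?oppr_ge0.
    - by rewrite -topredE/= ?oppr_ge0.
    - by rewrite oppr_ge0.
  exists 0 => //; near=> t.
  have t0 : 0 < t by near: t; exact: nbhs_right_gt.
  have phit : phi t <= 0 by near: t; exact: (cvgr_le _ phi_cvg).
  by rewrite mulr_ge0_le0// exprz_ge0// ltW.
have dK : primitive_on 0 T (fun t => K * t) (fun=> K).
  by move=> t _; apply: is_derive_eq; rewrite /GRing.scale/= mulr1.
have [D LD] := primitive_near_le T_gt0 dL dK LK.
pose k := expR (- (c * D)) / (2 * w0).
have k0 : 0 < k by rewrite divr_gt0 ?expR_gt0// mulr_gt0.
apply: (primitive_above_inv_diverges T_gt0 k0 dG); near=> t.
have t0 : 0 < t by near: t; exact: nbhs_right_gt.
have t1 : t <= 1 by near: t; exact: nbhs_right_le.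
have Kt : K * t <= L t + D by near: t.
have /andP[+ _] : expR (c * L t) / t ^+ alpha * (2 * w0)^-1 <= g t
    <= expR (c * L t) / t ^+ alpha * (2 / w0).
  by near: t; exact: singular_weight_bounds sing.
apply: le_trans; rewrite /k mulrAC ler_wpM2r//.
  by rewrite invr_ge0 mulr_ge0// ltW.
apply: ler_pM; rewrite ?expR_ge0 ?invr_ge0 ?(ltW t0)//.
  rewrite ler_expR -mulrN ler_wpM2l ?(ltW c_gt0)//.
  have := mulr_ge0 K0 (ltW t0); lra.
by rewrite lef_pV2 ?posrE ?exprn_gt0// exprn_le_id.
Unshelve. all: by end_near. Qed.


Lemma expRN_le_exprn (x : R) (n : nat) : 0 < x ->
  expR (- x) <= n.+1`!%:R / x ^+ n.+1.
Proof.
move=> x0; have xn : 0 < x ^+ n.+1 / n.+1`!%:R.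
  by rewrite divr_gt0 ?exprn_gt0// ltr0n fact_gt0.
rewrite expRN -invf_div lef_pV2 ?posrE ?expR_gt0//.
apply: le_trans (expR_ge1Dxn n (ltW x0)).
by rewrite lerDr.
Qed.

(** The derivative of the exponent dominates k / t ^ 2, so the exponent is at most
- k / t plus a constant, and exp(- c k / t) absorbs every power of t. *)
Lemma singular_weight_flat (c T w0 phi0 : R) alpha m
    (w phi L g G : R -> R) :
  exp_singularity c T w0 phi0 alpha m w phi L g G -> 2 <= m -> 0 < phi0 ->
  forall M : nat, exists C, \forall t \near 0^'+, 0 <= g t <= C * t ^+ M.
Proof.
move=> sing m2 phi0_gt0 M.
have [c_gt0 T_gt0 alpha_gt0 w0_gt0 w_cvg phi_cvg dL gE dG] := sing.
pose k := phi0 / 2.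
have k0 : 0 < k by rewrite /k; lra.
have kphi : k < phi0 by rewrite /k; lra.
have dk : primitive_on 0 T (fun t => - (k * t^-1)) (fun t => k * t ^- 2).
  move=> t /[!in_itv]/= /andP[t0 _].
  have tN0 : (id : R -> R) t != 0 by rewrite gt_eqF.
  have ? := is_deriveV tN0 (is_derive_id t 1).
  apply: is_derive_eq.
  by rewrite /GRing.scale/= mulr1 mulrN opprK.
have [D LD] : exists D, \forall t \near 0^'+, L t <= - (k * t^-1) + D.
  apply: (primitive_near_le T_gt0 dk dL); near=> t.
  have t0 : 0 < t by near: t; exact: nbhs_right_gt.
  have t1 : t <= 1 by near: t; exact: nbhs_right_le.
  have phit : k <= phi t by near: t; exact: (cvgr_ge _ phi_cvg).
  rewrite mulrC ler_pM ?invr_ge0 ?exprn_ge0 ?(ltW t0) ?(ltW k0)//.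
  have := @ler_wniXz2l _ t (ltW t0) t1 (- 2%:Z) (- m); rewrite -exprnN; apply.
  - by rewrite -topredE/= ?oppr_lt0 ?(lt_le_trans _ m2).
  - by rewrite -topredE/= ?oppr_lt0 ?(lt_le_trans _ m2).
  - by rewrite lerN2.
(* The exponential bound is used at order M + alpha + 1: M for the power claimed,
   alpha for the denominator, and the last factor t is bounded by 1. *)
pose N := (M + alpha)%N.
exists (expR (c * D) * (N.+1`!%:R / (c * k) ^+ N.+1) * (2 / w0)); near=> t.
have t0 : 0 < t by near: t; exact: nbhs_right_gt.
have t1 : t <= 1 by near: t; exact: nbhs_right_le.
have Lt : L t <= - (k * t^-1) + D by near: t.
have /andP[glo ghi] : expR (c * L t) / t ^+ alpha * (2 * w0)^-1 <= g t
    <= expR (c * L t) / t ^+ alpha * (2 / w0).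
  by near: t; exact: singular_weight_bounds sing.
apply/andP; split.
  apply: le_trans glo; rewrite !mulr_ge0 ?expR_ge0 ?invr_ge0 ?exprn_ge0 ?(ltW t0)//.
  by rewrite mulr_ge0// ltW.
apply: le_trans ghi _; rewrite [leRHS]mulrAC ler_wpM2r ?divr_ge0 ?(ltW w0_gt0)//.
rewrite ler_pdivrMr ?exprn_gt0// -!mulrA -exprD -/N.
have : expR (c * L t) <= expR (c * D) * expR (- (c * k / t)).
  rewrite -expRD ler_expR -mulrA -mulrN -mulrDr ler_wpM2l ?(ltW c_gt0)//.
  by rewrite addrC.
move=> /le_trans; apply; rewrite ler_wpM2l ?expR_ge0//.
have ckt : 0 < c * k / t by rewrite divr_gt0// mulr_gt0.
apply: le_trans (expRN_le_exprn N ckt) _.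
rewrite expr_div_n invf_div ler_wpM2l// mulrC ler_wpM2l//.
  by rewrite invr_ge0 exprn_ge0// mulr_ge0 ?ltW.
by rewrite exprS ler_piMl// exprn_ge0// ltW.
Unshelve. all: by end_near. Qed.

(** The Lipschitz condition makes the difference between phi t / t and phi0 / t
bounded by K, so the exponent is phi0 ln t up to a bounded term. *)
Lemma singular_weight_power (c T w0 phi0 : R) alpha
    (w phi L g G : R -> R) (K : R) :
  exp_singularity c T w0 phi0 alpha 1 w phi L g G ->
  (\forall t \near 0^'+, `|phi t - phi0| <= K * t) ->
  exists k1 k2 : R, [/\ 0 < k1, 0 < k2 & \forall t \near 0^'+,
    k1 * t `^ (c * phi0 - alpha%:R) <= g t
      <= k2 * t `^ (c * phi0 - alpha%:R)].
Proof.
move=> sing phiK.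
have [c_gt0 T_gt0 alpha_gt0 w0_gt0 w_cvg phi_cvg dL gE dG] := sing.
have dP (C : R) : primitive_on 0 T (fun t => phi0 * ln t + C * t)
    (fun t => phi0 * t^-1 + C).
  move=> t /[!in_itv]/= /andP[t0 _].
  have ? := is_derive1_ln t0.
  by apply: is_derive_eq; rewrite /GRing.scale/= mulr1.
have [D1 L1] : exists D, \forall t \near 0^'+, L t <= phi0 * ln t + - K * t + D.
  apply: (primitive_near_le T_gt0 (dP _) dL); near=> t.
  have t0 : 0 < t by near: t; exact: nbhs_right_gt.
  have : `|phi t - phi0| <= K * t by near: t.
  rewrite ler_norml => /andP[phit _].
  rewrite exprN1 [_^-1 * _]mulrC ler_pdivlMr// mulrDl mulfVK ?gt_eqF//; lra.
have [D2 L2] : exists D, \forall t \near 0^'+, phi0 * ln t + K * t <= L t + D.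
  apply: (primitive_near_le T_gt0 dL (dP _)); near=> t.
  have t0 : 0 < t by near: t; exact: nbhs_right_gt.
  have : `|phi t - phi0| <= K * t by near: t.
  rewrite ler_norml => /andP[_ phit].
  rewrite exprN1 [_^-1 * _]mulrC ler_pdivrMr// mulrDl mulfVK ?gt_eqF//; lra.
exists (expR (c * (- `|K| - D2)) / (2 * w0)).
exists (expR (c * (`|K| + D1)) * (2 / w0)); split.
- by rewrite divr_gt0 ?expR_gt0// mulr_gt0.
- by rewrite mulr_gt0 ?expR_gt0// divr_gt0.
near=> t.
have t0 : 0 < t by near: t; exact: nbhs_right_gt.
have t1 : t <= 1 by near: t; exact: nbhs_right_le.
have Kt : `|K * t| <= `|K| by rewrite normrM (gtr0_norm t0) ler_piMr.
have /andP[glo ghi] : expR (c * L t) / t ^+ alpha * (2 * w0)^-1 <= g t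
    <= expR (c * L t) / t ^+ alpha * (2 / w0).
  by near: t; exact: singular_weight_bounds sing.
have Lhi : L t <= phi0 * ln t + - K * t + D1 by near: t.
have Llo : phi0 * ln t + K * t <= L t + D2 by near: t.
move: Kt; rewrite ler_norml => /andP[Kt1 Kt2].
have powE : t `^ (c * phi0 - alpha%:R) = expR (c * (phi0 * ln t)) / t ^+ alpha.
  rewrite powRB; last by rewrite (gt_eqF t0) implybT.
  by rewrite powR_mulrn ?(ltW t0)// /powR gt_eqF// mulrA.
rewrite powE; apply/andP; split.
  apply: le_trans glo; rewrite mulrAC ler_wpM2r ?invr_ge0 ?mulr_ge0 ?(ltW w0_gt0)//.
    rewrite [leLHS]mulrA ler_wpM2r ?invr_ge0 ?exprn_ge0 ?(ltW t0)//.
  rewrite -expRD ler_expR -mulrDr ler_wpM2l ?(ltW c_gt0)//; lra.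
apply: le_trans ghi _; rewrite [leRHS]mulrAC ler_wpM2r ?divr_ge0 ?(ltW w0_gt0)//.
rewrite [leRHS]mulrA ler_wpM2r ?invr_ge0 ?exprn_ge0 ?(ltW t0)//.
rewrite -expRD ler_expR -mulrDr ler_wpM2l ?(ltW c_gt0)//; lra.
Unshelve. all: by end_near. Qed.

End exponential_singularity.
(** * Removing the root from the numerator and the denominator *)

Local Notation cofactor := Defs.cofactor.

Section polynomial_part.
Context {R : realType}.
Implicit Types (a b : {poly R}).

Lemma cofactorE a r : a != 0 ->
  ('X - r%:P) ^+ mup r a * cofactor a r = a.
Proof.
by move=> a0; rewrite mulrC /cofactor divpK// -mup_geq.
Qed.

Lemma cofactor_neq0 a r : a != 0 -> (cofactor a r).[r] != 0.
Proof.
move=> a0; apply/negP => /eqP/rootP; rewrite root_factor_theorem.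
move=> /(dvdp_mul (dvdpp (('X - r%:P) ^+ mup r a))).
by rewrite cofactorE// -exprSr -mup_geq// ltnn.
Qed.

Lemma horner_cofactor a r x : a != 0 ->
  a.[x] = (x - r) ^+ mup r a * (cofactor a r).[x].
Proof. by move=> a0; rewrite -{1}(cofactorE r a0) hornerM horner_exp !hornerE. Qed.

Lemma phi_neq0 a b r : a != 0 -> b != 0 -> phi a b r r != 0.
Proof. by move=> a0 b0; rewrite mulf_neq0 ?invr_eq0 ?cofactor_neq0. Qed.

Lemma ratio_phiE a b r x : a != 0 -> b != 0 -> x != r ->
  b.[x] / a.[x] = (x - r) ^ ((mup r b)%:Z - (mup r a)%:Z) * phi a b r x.
Proof.
move=> a0 b0 xr; rewrite (horner_cofactor r x a0) (horner_cofactor r x b0) /phi.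
rewrite expfzDr ?subr_eq0// -exprnN -exprnP invfM.
by rewrite -!mulrA; congr (_ * _); rewrite mulrCA.
Qed.

Lemma derivable_phi a b r : a != 0 ->
  derivable (phi a b r) r 1.
Proof.
move=> a0; apply: derivableM; first exact: derivable_horner.
by apply: derivableV; [exact: cofactor_neq0|exact: derivable_horner].
Qed.

Lemma phi_continuous a b r : a != 0 -> {for r, continuous (phi a b r)}.
Proof.
move=> a0; apply/differentiable_continuous/derivable1_diffP.
exact: derivable_phi.
Qed.

(** The difference quotient of phi at r converges, hence is bounded near r. *)
Lemma phi_lipschitz a b r : a != 0 -> exists K,
  \forall x \near r, `|phi a b r x - phi a b r r| <= K * `|x - r|.
Proof.
move=> /derivable_phi-/(_ b r) dphi.
exists (`|'D_1 (phi a b r) r| + 1).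
have [d /= d0 Hd] : \forall h \near 0^',
    `|h^-1 *: (phi a b r (h *: 1 + r) - phi a b r r)| <=
    `|'D_1 (phi a b r) r| + 1.
  by apply: (cvgr_norm_le _ dphi); rewrite ltrDl.
exists d => //= x /= xd.
have [->|xr] := eqVneq x r; first by rewrite !subrr !normr0 mulr0.
have xr0 : x - r != 0 by rewrite subr_eq0.
have := Hd (x - r); rewrite /= sub0r normrN distrC => /(_ xd xr0).
rewrite /GRing.scale/= mulr1 subrK normrM normfV mulrC.
by rewrite ler_pdivrMr ?normr_gt0// [`|r - x|]distrC.
Qed.
End polynomial_part.

(** * The weight as a solution of a differential equation *)

Section weight.
Context {R : realType} (n : nat) (a b : {poly R}) (u v p0 : R).
Context (a_zf : zero_free a u v) (p0_in : p0 \in `]u, v[).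
Local Notation c := (2 / n%:R : R).
Local Notation p := (weight n a b p0).

Lemma ratio_continuous : {in `]u, v[, continuous (fun t => b.[t] / a.[t])}.
Proof.
move=> x xI; apply: cvgM; first exact: continuous_horner.
by apply: cvgV; [exact: a_zf|exact: continuous_horner].
Qed.

Definition weight_exponent := oriented_integral (fun t => b.[t] / a.[t]) p0.

Lemma weight_exponent_primitive :
  primitive_on u v weight_exponent (fun t => b.[t] / a.[t]).
Proof. exact: is_derive_oriented_integral ratio_continuous p0_in. Qed.

(** The logarithmic derivative of the weight is c b / a - a' / a. *)
Lemma is_derive_weight x : x \in `]u, v[ ->
  is_derive x 1 p (p x * (c * b.[x] - a^`().[x]) / a.[x]).
Proof.
move=> xI; have ax := a_zf xI.
have dE := weight_exponent_primitive xI.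
(* Near x, |a| coincides with the polynomial s *: a, which has a derivative. *)
pose s := Num.sg a.[x].
have sax : (s *: a).[x] != 0 by rewrite hornerZ mulf_neq0 ?sgr_eq0.
have near_p : \near x, (s *: a).[x]^-1 * expR (c * weight_exponent x) = p x.
  near=> y; rewrite /weight; congr (_^-1 * _).
  have sy : 0 < (s *: a).[y].
    near: y; apply: (cvgr_gt _ (continuous_horner (p := s *: a) (x := x))).
    by rewrite hornerZ -normrEsg normr_gt0.
  rewrite -(gtr0_norm sy) hornerZ normrM normr_sg ax mul1r//.
apply: (near_eq_is_derive near_p _).
have dV := is_deriveV sax (is_derive_poly (s *: a) x).
have dX : is_derive x 1 (fun y => expR (c * weight_exponent y))
    (expR (c * weight_exponent x) * (c * (b.[x] / a.[x]))).
  have dc : is_derive x 1 (fun y => c * weight_exponent y)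
      (c * (b.[x] / a.[x])).
    exact: is_deriveZ.
  exact: (@is_derive1_comp _ expR (fun y => c * weight_exponent y)).
apply: is_derive_eq (is_deriveM dV dX) _.
rewrite -(nbhs_singleton near_p) derivZ !hornerZ /GRing.scale/=.
move: (2 / n%:R) => k; field.
by rewrite ax sgr_eq0 ax.
Unshelve. all: by end_near. Qed.


Lemma weight_continuous : {in `]u, v[, continuous p}.
Proof. by move=> x /is_derive_weight /is_derive_continuous. Qed.

Lemma weight_primitive :
  primitive_on u v (oriented_integral p p0) p.
Proof. exact: is_derive_oriented_integral weight_continuous p0_in. Qed.

End weight.

(** * The singularity of the weight along a ray *)

Section singularity_of_weight.
Context {R : realType} (n : nat) (a b : {poly R}) (r u v p0 sigma T : R).
Context (n_gt0 : (0 < n)%N) (a_neq0 : a != 0) (b_neq0 : b != 0).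
Context (a_root : root a r) (a_zf : zero_free a u v).
Context (p0_in : p0 \in `]u, v[) (sigmaE : sigma = 1 \/ sigma = -1).
Context (T_gt0 : 0 < T).
Context (ray : forall t, t \in `]0, T[ -> r + sigma * t \in `]u, v[).
Local Notation p := (weight n a b p0).
Local Notation alpha := (mup r a).
Local Notation m := ((mup r a)%:Z - (mup r b)%:Z).
Local Notation P := (oriented_integral p p0).

(** The sign produced in b / a by the substitution x = r + sigma t: one factor
sigma comes from dx = sigma dt, the others from (sigma t) ^ (- m), where sigma ^ (- m) = sigma ^ m. *)
Definition side_sign := sigma * sigma ^ m.

Lemma ray_cvg (f : R -> R) : {for r, continuous f} ->
  f (r + sigma * t) @[t --> 0^'+] --> f r.
Proof.
move=> cf; apply: cvg_at_right_filter.
have -> : f r = f (r + sigma * 0) by rewrite mulr0 addr0.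
apply: continuous_comp.
  by apply: cvgD; [exact: cvg_cst|apply: cvgM; [exact: cvg_cst|exact: cvg_id]].
by rewrite mulr0 addr0.
Qed.

Lemma is_derive_ray (f : R -> R) t (df : R) :
  is_derive (r + sigma * t) 1 f df ->
  is_derive t 1 (fun t => f (r + sigma * t)) (sigma * df).
Proof.
move=> Df.
have Dray : is_derive t 1 (fun t => r + sigma * t) sigma.
  have := is_deriveD (is_derive_cst r t 1) (is_deriveZ sigma (is_derive_id t 1)).
  by rewrite add0r /GRing.scale/= mulr1.
by rewrite mulrC; exact: (@is_derive1_comp _ f (fun t => r + sigma * t)).
Qed.

(** The primitive of t |-> p (r + sigma t) is sigma times that of p because
sigma ^ 2 = 1. *)
Lemma weight_exp_singularity :
  exp_singularity (2 / n%:R) T `|(cofactor a r).[r]|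
    (side_sign * phi a b r r) alpha m
    (fun t => `|(cofactor a r).[r + sigma * t]|)
    (fun t => side_sign * phi a b r (r + sigma * t))
    (fun t => weight_exponent a b p0 (r + sigma * t))
    (fun t => p (r + sigma * t))
    (fun t => sigma * P (r + sigma * t)).
Proof.
have sigma0 : sigma != 0.
  by case: sigmaE => ->; rewrite ?oppr_eq0 oner_eq0.
have ss : sigma * sigma = 1 by case: sigmaE => ->; rewrite ?mulrNN mulr1.
have sigmaN (k : int) : sigma ^ (- k) = sigma ^ k.
  by rewrite -exprz_inv; congr (_ ^ _); rewrite -[LHS]mul1r -ss mulfK.
split => //.
- by rewrite divr_gt0// ltr0n.
- by rewrite -XsubC_dvd// dvdp_XsubCl.
- by rewrite normr_gt0 cofactor_neq0.
- apply: (@ray_cvg (fun x => `|(cofactor a r).[x]|)).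
  by apply: cvg_norm; exact: continuous_horner.
- apply: (@ray_cvg (fun x => side_sign * phi a b r x)).
  by apply: cvgM; [exact: cvg_cst|exact: phi_continuous].
- move=> t tT; have rI := ray tT.
  move: tT; rewrite in_itv/= => /andP[t0 _].
  have dE := weight_exponent_primitive b a_zf p0_in rI.
  apply: is_derive_eq (is_derive_ray dE) _.
  have st0 : sigma * t != 0 by rewrite mulf_neq0// gt_eqF.
  have rst : r + sigma * t != r by rewrite -subr_eq0 addrAC subrr add0r.
  rewrite (ratio_phiE a_neq0 b_neq0 rst) addrAC subrr add0r.
  rewrite expfzMl -(opprB (mup r a)%:Z) sigmaN /side_sign.
  by rewrite -!mulrA [LHS]mulrA [LHS]mulrCA -!mulrA.
- near=> t; have t0 : 0 < t by near: t; exact: nbhs_right_gt.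
  rewrite /weight mulrC; congr (_ / _).
  rewrite (horner_cofactor r _ a_neq0) addrAC subrr add0r normrM normrX normrM.
  suff -> : `|sigma| = 1 by rewrite mul1r gtr0_norm.
  by case: sigmaE => ->; rewrite ?normrN normr1.
- move=> t tT.
  have dP := is_derive_ray (weight_primitive n b a_zf p0_in (ray tT)).
  apply: is_derive_eq (is_deriveZ sigma dP) _.
  by rewrite /GRing.scale/= mulrA ss mul1r.
Unshelve. all: by end_near. Qed.

End singularity_of_weight.

(** * Iterated one-sided derivatives *)

Section iterated_side_derivative.
Context {R : realType} (F : set_system R) {FF : ProperFilter F}.
Context (F_dnbhs : F `=>` (0 : R)^').

(** The filter F is 0^'+ or 0^'- in the applications, so this is the right or the
left derivative. *)
Definition side_derive (f : R -> R) (x : R) : R :=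
  lim (diff_quotient f x h @[h --> F]).

Lemma diff_quotient_cvg (f : R -> R) (x df : R) : is_derive x 1 f df ->
  diff_quotient f x h @[h --> F] --> df.
Proof.
move=> [dfx <-]; apply: cvg_trans (cvg_app _ F_dnbhs) _.
rewrite [X in X @ _](_ : _ = fun h => h^-1 *: (f (h *: 1 + x) - f x)).
  exact: dfx.
by apply/funext => h; rewrite /diff_quotient/= /GRing.scale/= mulr1 [x + h]addrC.
Qed.


(** Inside I, a one-sided derivative is an ordinary one and only depends on values
in I; at r, it only depends on f k along r + F, where f k is negligible compared
with the increment. So each derivation goes from f k to f k.+1 on r and I at
once. *)
Lemma iter_side_derive (f : nat -> R -> R) (r : R) (I : set R) :
  open I ->
  (forall k (x : R), I x -> is_derive x 1 (f k) (f k.+1 x)) ->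
  (forall k, f k r = 0) ->
  (\forall h \near F, I (r + h)) ->
  (forall k, h^-1 * f k (r + h) @[h --> F] --> 0) ->
  [/\ forall k x, x = r \/ I x -> iter k side_derive (f 0%N) x = f k x,
      forall k (x : R), I x -> derivable (iter k side_derive (f 0%N)) x 1
    & forall k, cvg (diff_quotient (iter k side_derive (f 0%N)) r @ F)].
Proof.
move=> oI df f0 Ir cf.
have near_I x : I x -> \near x, I x by move=> Ix; exact: open_nbhs_nbhs.
have cr (g : R -> R) k : (forall x, x = r \/ I x -> g x = f k x) ->
    diff_quotient g r h @[h --> F] --> 0.
  move=> gf; apply: cvg_trans (cf k); apply: near_eq_cvg.
  near=> h; rewrite /diff_quotient !gf; [|by left|right; near: h; exact: Ir].
  by rewrite f0 subr0.
have dI (g : R -> R) k (x : R) : (forall x, x = r \/ I x -> g x = f k x) ->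
    I x -> is_derive x 1 g (f k.+1 x).
  move=> gf Ix; apply: near_eq_is_derive (df k x Ix).
  by near=> y; apply/esym/gf; right; near: y; exact: near_I.
have iterE k x : x = r \/ I x -> iter k side_derive (f 0%N) x = f k x.
  elim: k x => // k IH x [->|Ix] /=.
    by rewrite f0; apply: cvg_lim => //; exact: cr IH.
  by apply: cvg_lim => //; exact: diff_quotient_cvg (dI _ _ _ IH Ix).
split=> // k; last by apply: cvgP; exact: cr (iterE k).
by move=> x Ix; have [] := dI _ _ _ (iterE k) Ix.
Unshelve. all: by end_near. Qed.

End iterated_side_derivative.

(** * Derivatives of the weight *)

Section derivatives_of_weight.
Context {R : realType} (n : nat) (a b : {poly R}) (r u v p0 : R).
Context (a_zf : zero_free a u v) (p0_in : p0 \in `]u, v[).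
Local Notation c := (2 / n%:R : R).
Local Notation p := (weight n a b p0).

(** The numerators N_k in p^(k) = p N_k / a ^ k, read off from
p' = p (c b - a') / a. *)
Fixpoint derive_num (k : nat) : {poly R} :=
  if k is j.+1 then
    derive_num j * (c *: b - a^`() *+ j.+1) + (derive_num j)^`() * a
  else 1.

Definition weight_derivative k x :=
  if x == r then 0 else p x * (derive_num k).[x] / a.[x] ^+ k.

Lemma is_derive_weight_derivative k (x : R) : r \notin `]u, v[ -> x \in `]u, v[ ->
  is_derive x 1 (weight_derivative k) (weight_derivative k.+1 x).
Proof.
move=> rI xI; have ax := a_zf xI.
have xr : x != r by apply: contraNneq rI => <-.
have dp := is_derive_weight n b a_zf p0_in xI.
have axk : (a ^+ k).[x] != 0 by rewrite horner_exp expf_neq0.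
have dV := is_deriveV axk (is_derive_poly (a ^+ k) x).
have dN := is_derive_poly (derive_num k) x.
have near_f : \near x,
    (p x * (derive_num k).[x]) * (a ^+ k).[x]^-1 = weight_derivative k x.
  near=> y; rewrite /weight_derivative ifF ?horner_exp//; apply/negbTE.
  apply: contraNN rI => /eqP <-.
  by near: y; exact: near_in_itvoo.
apply: (near_eq_is_derive near_f).
apply: is_derive_eq (is_deriveM (is_deriveM dp dN) dV) _.
have dak : (a ^+ k)^`().[x] = k%:R * a.[x] ^+ k * a^`().[x] / a.[x].
  case: k {axk dV dN near_f} => [|j]; first by rewrite derivC horner0 !mul0r.
  rewrite deriv_exp hornerMn hornerM horner_exp /= -mulr_natl exprSr.
  by field.
rewrite dak /weight_derivative (negbTE xr) /= horner_exp.
rewrite hornerD !hornerM hornerD hornerN hornerZ hornerMn.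
rewrite -[_ *+ k.+1]mulr_natl [a.[x] ^+ k.+1]exprSr -natr1 /GRing.scale/=.
have -> : (p * horner (derive_num k)) x = p x * (derive_num k).[x] by [].
have ak : a.[x] ^+ k != 0 by rewrite expf_neq0.
move: (2 / n%:R) (a.[x] ^+ k) ak => C A A0.
by field; rewrite A0 ax.
Unshelve. all: by end_near. Qed.


(** Near r, the denominator a ^ k is of the order of |h| ^ (alpha k), so a bound of
p by |h| ^ (alpha k + 2) leaves a factor |h| in the difference quotient. *)
Lemma weight_derivative_flat (F : set_system R) k : ProperFilter F ->
  F `=>` (0 : R)^' -> a != 0 ->
  (forall M : nat, exists C, \forall h \near F,
    0 <= p (r + h) <= C * `|h| ^+ M) ->
  h^-1 * weight_derivative k (r + h) @[h --> F] --> 0.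
Proof.
move=> FF F0 a0 p_flat.
have F_id : (fun h : R => h) @ F --> (0 : R).
  by apply: cvg_trans (cvg_app _ F0) _; exact: cvg_within.
have F_shift (q : {poly R}) : q.[r + h] @[h --> F] --> q.[r].
  apply: (@cvg_comp _ _ _ (fun h => r + h) (horner q) F (nbhs r)).
    have : r + h @[h --> F] --> r + 0 by apply: cvgD F_id; exact: cvg_cst.
    by rewrite addr0.
  exact: continuous_horner.
pose N := derive_num k; pose q := cofactor a r.
have [C pC] := p_flat (mup r a * k + 2)%N.
have q0 : 0 < `|q.[r]| by rewrite normr_gt0 cofactor_neq0.
have q_half : `|q.[r]| / 2 < `|q.[r]| by lra.
pose K := C * (`|N.[r]| + 1) / (`|q.[r]| / 2) ^+ k.
apply/norm_cvg0P.
apply: (squeeze_cvgr (f := fun=> 0) (h := fun h => K * `|h|)).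
- near=> h; rewrite normr_ge0/=.
  have h0 : h != 0 by near: h; apply: F0; exists 1 => /=.
  have rh : r + h != r by rewrite -subr_eq0 addrAC subrr add0r.
  have /andP[p0h ph] : 0 <= p (r + h) <= C * `|h| ^+ (mup r a * k + 2).
    by near: h.
  have Nh : `|N.[r + h]| <= `|N.[r]| + 1.
    by near: h; apply: (cvgr_norm_le _ (F_shift N)); rewrite ltrDl.
  have qh : `|q.[r]| / 2 <= `|q.[r + h]|.
    by near: h; exact: (cvgr_norm_ge _ (F_shift q)).
  have hn : 0 < `|h| by rewrite normr_gt0.
  have qk : 0 < (`|q.[r]| / 2) ^+ k by rewrite exprn_gt0// divr_gt0.
  rewrite /weight_derivative (negbTE rh) (horner_cofactor r _ a0).
  move: p0h ph; move: (p (r + h)) => y p0h ph.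
  rewrite addrAC subrr add0r exprMn -exprM !normrM !normfV !normrM !normrX.
  rewrite (ger0_norm p0h).
  have X0 : 0 < `|h| ^+ (mup r a * k) by rewrite exprn_gt0.
  have Qk : (`|q.[r]| / 2) ^+ k <= `|q.[r + h]| ^+ k.
    by rewrite lerXn2r// nnegrE// divr_ge0.
  have num : y * `|N.[r + h]| <=
      C * `|h| ^+ (mup r a * k + 2) * (`|N.[r]| + 1) by rewrite ler_pM.
  have den : (`|h| ^+ (mup r a * k) * `|q.[r + h]| ^+ k)^-1 <=
      (`|h| ^+ (mup r a * k) * (`|q.[r]| / 2) ^+ k)^-1.
    by rewrite lef_pV2 ?posrE ?mulr_gt0// ?ler_pM2l// (lt_le_trans qk).
  have -> : K * `|h| = `|h|^-1 * (C * `|h| ^+ (mup r a * k + 2) *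
      (`|N.[r]| + 1) * (`|h| ^+ (mup r a * k) * (`|q.[r]| / 2) ^+ k)^-1).
    rewrite /K exprD; move: qk X0.
    move: ((_ / 2) ^+ k) (`|h| ^+ (mup r a * k)) => Q X Q0 X0.
    by field; rewrite !gt_eqF.
  rewrite ler_wpM2l ?invr_ge0// ler_pM// ?mulr_ge0// invr_ge0 mulr_ge0.
- exact: cvg_cst.
- rewrite -[X in _ --> X](mulr0 K); apply: cvgM; first exact: cvg_cst.
  by rewrite -(@normr0 _ R); exact: cvg_norm.
Unshelve. all: by end_near. Qed.

End derivatives_of_weight.

Section side_smoothness.
Context {R : realType} (n : nat) (a b : {poly R}) (r u v p0 : R).
Context (a_neq0 : a != 0) (a_zf : zero_free a u v) (p0_in : p0 \in `]u, v[).
Context (r_notin : r \notin `]u, v[).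
Local Notation p := (weight n a b p0).

Lemma set_zero_weightE : set_zero_at p r = weight_derivative n a b r p0 0.
Proof.
apply/funext => x; rewrite /set_zero_at /weight_derivative.
by rewrite hornerC expr0 divr1 mulr1.
Qed.

Lemma weight_side_smooth (F : set_system R) : ProperFilter F ->
  F `=>` (0 : R)^' -> (\forall h \near F, r + h \in `]u, v[) ->
  (forall M : nat, exists C, \forall h \near F,
    0 <= p (r + h) <= C * `|h| ^+ M) ->
  [/\ forall k, iter k (side_derive F) (set_zero_at p r) r = 0,
      forall k (x : R), x \in `]u, v[ ->
        derivable (iter k (side_derive F) (set_zero_at p r)) x 1
    & forall k,
        cvg (diff_quotient (iter k (side_derive F) (set_zero_at p r)) r @ F)].
Proof.
move=> FF F0 FI p_flat; rewrite set_zero_weightE.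
have [|||||iterE dI dr] := @iter_side_derive _ F FF F0
    (weight_derivative n a b r p0) r [set` `]u, v[].
- exact: interval_open.
- by move=> k x xI; exact: (is_derive_weight_derivative n b a_zf p0_in k r_notin xI).
- by move=> k; rewrite /weight_derivative eqxx.
- exact: FI.
- by move=> k; exact: weight_derivative_flat.
split=> // k; rewrite iterE; last by left.
by rewrite /weight_derivative eqxx.
Qed.

End side_smoothness.

(** * Integrability on one side of the root *)

Section side_integrability.
Context {R : realType} (n : nat) (a b : {poly R}) (r u v p0 sigma T : R).
Context (n_gt0 : (0 < n)%N) (a_neq0 : a != 0) (b_neq0 : b != 0).
Context (a_root : root a r) (a_zf : zero_free a u v).
Context (p0_in : p0 \in `]u, v[) (sigmaE : sigma = 1 \/ sigma = -1).
Context (T_gt0 : 0 < T).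
Context (ray : forall t, t \in `]0, T[ -> r + sigma * t \in `]u, v[).
Local Notation p := (weight n a b p0).
Local Notation alpha := (mup r a).
Local Notation m := ((mup r a)%:Z - (mup r b)%:Z).
Local Notation phir := (phi a b r r).
Local Notation P := (oriented_integral p p0).
Local Notation S := (side_sign a b r sigma).

Let singularity := weight_exp_singularity n_gt0 a_neq0 b_neq0 a_root a_zf p0_in
  sigmaE T_gt0 ray.

Lemma is_cvg_signed (f : R -> R) :
  cvg (sigma * f t @[t --> 0^'+]) <-> cvg (f @ 0^'+).
Proof.
split=> cf; last by apply: is_cvgM; [exact: is_cvg_cst|].
apply: near_eq_is_cvg (is_cvgM (is_cvg_cst sigma) cf).
apply: nearW => t /=; rewrite mulrA.
by case: sigmaE => ->; rewrite ?mulrNN !mul1r.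
Qed.

Lemma weight_flat : 2 <= m -> 0 < S * phir ->
  forall M : nat, exists C, \forall t \near 0^'+,
    0 <= p (r + sigma * t) <= C * t ^+ M.
Proof. by move=> m2 phi0; exact: singular_weight_flat singularity m2 phi0. Qed.

(** When the condition fails and m is not 1, either m <= 0 or S * phi(r) < 0, since
S * phi(r) is not 0; in both cases the weight dominates a multiple of 1 / t. *)
Lemma ordinary_integrableP : m != 1 ->
  cvg (P (r + sigma * t) @[t --> 0^'+]) <-> 2 <= m /\ 0 < S * phir.
Proof.
move=> m1; rewrite -(is_cvg_signed (fun t => P (r + sigma * t))).
have dG := sing_weight_primitive singularity.
split=> [cP|[m2 phi0]]; last first.
  have [C gC] := weight_flat m2 phi0 0.
  apply: (primitive_bounded_is_cvg (C := C) T_gt0 dG).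
  by apply: filterS gC => t; rewrite mulr1.
have ndiv := singular_weight_diverges singularity.
have m2 : 2 <= m.
  by rewrite leNgt; apply/negP => m2; apply: ndiv cP; left; lia.
split=> //; rewrite lt_neqAle eq_sym leNgt; apply/andP; split.
  have sigma0 : sigma != 0.
    by case: sigmaE => ->; rewrite ?oppr_eq0 oner_eq0.
  have S0 : S != 0 by rewrite /side_sign mulf_neq0// expfz_neq0.
  by rewrite (mulf_neq0 S0)// phi_neq0.
by apply/negP => phi0; apply: ndiv cP; right.
Qed.

Definition power_model (x : R) : R :=
  (`|x - r| `^ (2 / n%:R * phir)) / `|x - r| ^+ alpha.
Local Notation q := power_model.
Local Notation Q := (oriented_integral q p0).

Context (r_notin : r \notin `]u, v[).

Lemma power_model_continuous : {in `]u, v[, continuous q}.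
Proof.
move=> x xI.
have xr : 0 < `|x - r|.
  by rewrite normr_gt0 subr_eq0; apply: contraNneq r_notin => <-.
have norm_cvg : `|y - r| @[y --> x] --> `|x - r|.
  by apply: cvg_norm; apply: cvgB; [exact: cvg_id|exact: cvg_cst].
apply: cvgM.
  apply: (@continuous_comp _ _ _ (fun y => `|y - r|) (fun y => y `^ _)) => //.
  exact: is_derive_continuous (is_derive1_powR _ xr).
apply: cvgV; first by rewrite expf_neq0 ?gt_eqF.
apply: (@continuous_comp _ _ _ (fun y => `|y - r|) (fun y => y ^+ _)) => //.
exact: exprn_continuous.
Qed.

Lemma power_model_primitive :
  primitive_on 0 T (fun t => sigma * Q (r + sigma * t))
    (fun t => t `^ (2 / n%:R * phir - alpha%:R)).
Proof.
move=> t tT; have rI := ray tT.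
have dQ := is_derive_oriented_integral power_model_continuous p0_in rI.
apply: is_derive_eq (is_deriveZ sigma (is_derive_ray dQ)) _.
have t0 : 0 < t by move: tT; rewrite in_itv/= => /andP[].
rewrite /GRing.scale/= mulrA /power_model addrAC subrr add0r.
have -> : sigma * sigma = 1 by case: sigmaE => ->; rewrite ?mulrNN mulr1.
have -> : `|sigma * t| = t.
  by case: sigmaE => ->; rewrite ?mulN1r ?mul1r ?normrN gtr0_norm.
by rewrite mul1r powRB ?powR_mulrn ?(ltW t0)// (gt_eqF t0) implybT.
Qed.

Lemma logarithmic_model_integrableP :
  cvg (Q (r + sigma * t) @[t --> 0^'+]) <->
  0 < 2 / n%:R * phir - alpha%:R + 1.
Proof.
rewrite -(is_cvg_signed (fun t => Q (r + sigma * t))).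
exact: primitive_powR_is_cvgP T_gt0 power_model_primitive.
Qed.

Lemma logarithmic_integrableP : m = 1 ->
  cvg (P (r + sigma * t) @[t --> 0^'+]) <->
  cvg (Q (r + sigma * t) @[t --> 0^'+]).
Proof.
move=> m1.
rewrite -(is_cvg_signed (fun t => P (r + sigma * t))).
rewrite -(is_cvg_signed (fun t => Q (r + sigma * t))).
have dG := sing_weight_primitive singularity.
have S1 : S = 1.
  by rewrite /side_sign m1 expr1z; case: sigmaE => ->; rewrite ?mulrNN mulr1.
have [K phiK] := phi_lipschitz b r a_neq0.
have [k1 [k2 [k10 k20 gk]]] : exists k1 k2 : R,
    [/\ 0 < k1, 0 < k2 & \forall t \near 0^'+,
    k1 * t `^ (2 / n%:R * phir - alpha%:R) <= p (r + sigma * t)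
      <= k2 * t `^ (2 / n%:R * phir - alpha%:R)].
  move: singularity; rewrite S1 m1 mul1r => sing.
  apply: (singular_weight_power (K := K) sing).
  have rt : r + sigma * t @[t --> 0^'+] --> r.
    by apply: (@ray_cvg _ r sigma id); exact: cvg_id.
  near=> t; have t0 : 0 < t by near: t; exact: nbhs_right_gt.
  have : `|phi a b r (r + sigma * t) - phir| <= K * `|r + sigma * t - r|.
    by near: t; exact: (rt _ phiK).
  rewrite mul1r addrAC subrr add0r normrM (gtr0_norm t0).
  by case: sigmaE => ->; rewrite ?normrN normr1 mul1r.
split=> [cP|cQ].
  apply: (is_cvg_primitive_comparison (C := k1^-1) T_gt0 dG
    power_model_primitive _ cP).
  apply: filterS gk => t /andP[k1g _].
  by rewrite powR_ge0/= [leRHS]mulrC ler_pdivlMr// mulrC.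
apply: (is_cvg_primitive_comparison (C := k2) T_gt0
  power_model_primitive dG _ cQ).
apply: filterS gk => t /andP[k1g ->]; rewrite andbT.
by apply: le_trans k1g; rewrite mulr_ge0 ?powR_ge0 ?ltW.
Unshelve. all: by end_near. Qed.

End side_integrability.

(** * Right and left sides *)

Lemma at_right_dnbhs (R : realType) : (0 : R)^'+ `=>` (0 : R)^'.
Proof.
by move=> A [e e0 Ae]; exists e => // x xe x0; apply: Ae; rewrite ?gt_eqF.
Qed.

Lemma at_left_dnbhs (R : realType) : (0 : R)^'- `=>` (0 : R)^'.
Proof.
by move=> A [e e0 Ae]; exists e => // x xe x0; apply: Ae; rewrite ?lt_eqF.
Qed.

Lemma near_at_left0 (R : realType) (A : R -> Prop) :
  (\forall t \near 0^'+, A (- t)) -> \forall h \near 0^'-, A h.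
Proof. by rewrite -{2}oppr0 at_leftN. Qed.

Section both_sides.
Context {R : realType} (n : nat) (a b : {poly R}) (r : R).
Context (n_gt0 : (0 < n)%N) (a_neq0 : a != 0) (b_neq0 : b != 0).
Context (a_root : root a r).
Local Notation m := ((mup r a)%:Z - (mup r b)%:Z).
Local Notation phir := (phi a b r r).
Local Notation q := (power_model n a b r).

Lemma right_side u p0 : zero_free a r u -> p0 \in `]r, u[ ->
  let p := weight n a b p0 in
  [/\ m != 1 -> integrable_from_right p r u <-> 2 <= m /\ 0 < phir,
      2 <= m -> 0 < phir -> right_smooth (set_zero_at p r) r /\
        forall k : nat, right_derive_n k (set_zero_at p r) r = 0,
      m = 1 -> integrable_from_right p r u <-> integrable_from_right q r u
    & integrable_from_right q r u <->
        0 < 2 / n%:R * phir - (mup r a)%:R + 1].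
Proof.
move=> a_zf p0_in p.
have ru : r < u by move: p0_in; rewrite in_itv/= => /andP[/lt_trans]; exact.
have T0 : 0 < u - r by rewrite subr_gt0.
have r_notin : r \notin `]r, u[ by rewrite in_itv/= ltxx.
have ray t : t \in `]0, u - r[ -> r + 1 * t \in `]r, u[.
  by rewrite !in_itv/= => /andP[t0 tu]; apply/andP; split; lra.
have sE : (1 : R) = 1 \/ (1 : R) = -1 by left.
have S1 : side_sign a b r 1 = 1 by rewrite /side_sign exp1rz mulr1.
have ray1 (F : R -> R) : (fun t => F (r + 1 * t)) = (fun t => F (r + t)).
  by apply/funext => t; rewrite mul1r.
have pP : integrable_from_right p r u <->
    cvg (oriented_integral p p0 (r + 1 * t) @[t --> 0^'+]).
  rewrite ray1; apply: integrable_from_rightP => //.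
    exact: weight_continuous.
  exact: weight_primitive.
have qP : integrable_from_right q r u <->
    cvg (oriented_integral q p0 (r + 1 * t) @[t --> 0^'+]).
  have cq := @power_model_continuous R n a b r _ _ r_notin.
  rewrite ray1; apply: integrable_from_rightP => //.
  exact: is_derive_oriented_integral cq p0_in.
split.
- move=> m1; rewrite pP.
  rewrite (ordinary_integrableP n_gt0 a_neq0 b_neq0 a_root a_zf p0_in sE T0
    ray m1).
  by rewrite S1 mul1r.
- move=> m2 phi0.
  have FI : \forall h \near 0^'+, r + h \in `]r, u[.
    near=> h; rewrite -[h in r + h]mul1r; apply: ray; rewrite in_itv/=; apply/andP.
    by split; near: h; [exact: nbhs_right_gt|exact: nbhs_right_lt].
  have flat M : exists C, \forall h \near 0^'+, 0 <= p (r + h) <= C * `|h| ^+ M.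
    have Sphi : 0 < side_sign a b r 1 * phir by rewrite S1 mul1r.
    have [C pC] := weight_flat n_gt0 a_neq0 b_neq0 a_root a_zf p0_in sE T0 ray
      m2 Sphi M.
    exists C; near=> h; rewrite gtr0_norm; last by near: h; exact: nbhs_right_gt.
    by rewrite -[h in r + h]mul1r; near: h.
  have [d0 dI dr] := weight_side_smooth a_neq0 a_zf p0_in r_notin _
    (@at_right_dnbhs R) FI flat.
  split=> //; exists (u - r) => // k; split; first exact: dr.
  by move=> x; rewrite subrKC; exact: dI.
- move=> m1; rewrite pP qP.
  exact: (logarithmic_integrableP n_gt0 a_neq0 b_neq0 a_root a_zf p0_in sE T0
    ray r_notin m1).
- rewrite qP.
  exact: (logarithmic_model_integrableP n a b p0_in sE T0 ray r_notin).
Unshelve. all: by end_near. Qed.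

Lemma left_side u p0 : zero_free a u r -> p0 \in `]u, r[ ->
  let p := weight n a b p0 in
  [/\ m != 1 -> integrable_from_left p r u <-> 2 <= m /\ (-1) ^ m * phir < 0,
      2 <= m -> (-1) ^ m * phir < 0 -> left_smooth (set_zero_at p r) r /\
        forall k : nat, left_derive_n k (set_zero_at p r) r = 0,
      m = 1 -> integrable_from_left p r u <-> integrable_from_left q r u
    & integrable_from_left q r u <->
        0 < 2 / n%:R * phir - (mup r a)%:R + 1].
Proof.
move=> a_zf p0_in p.
have ur : u < r by move: p0_in; rewrite in_itv/= => /andP[/lt_trans]; exact.
have T0 : 0 < r - u by rewrite subr_gt0.
have r_notin : r \notin `]u, r[ by rewrite in_itv/= ltxx andbF.
have ray t : t \in `]0, r - u[ -> r + (-1) * t \in `]u, r[.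
  by rewrite !in_itv/= => /andP[t0 tu]; apply/andP; split; lra.
have sE : (-1 : R) = 1 \/ (-1 : R) = -1 by right.
have S1 : side_sign a b r (-1) * phir = - ((-1) ^ m * phir).
  by rewrite /side_sign mulN1r mulNr.
have ray1 (F : R -> R) : (fun t => F (r + (-1) * t)) = (fun t => F (r - t)).
  by apply/funext => t; rewrite mulN1r.
have pP : integrable_from_left p r u <->
    cvg (oriented_integral p p0 (r + (-1) * t) @[t --> 0^'+]).
  rewrite ray1; apply: integrable_from_leftP => //.
    exact: weight_continuous.
  exact: weight_primitive.
have qP : integrable_from_left q r u <->
    cvg (oriented_integral q p0 (r + (-1) * t) @[t --> 0^'+]).
  have cq := @power_model_continuous R n a b r _ _ r_notin.
  rewrite ray1; apply: integrable_from_leftP => //.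
  exact: is_derive_oriented_integral cq p0_in.
split.
- move=> m1; rewrite pP.
  rewrite (ordinary_integrableP n_gt0 a_neq0 b_neq0 a_root a_zf p0_in sE T0
    ray m1).
  by rewrite S1 oppr_gt0.
- move=> m2 phi0.
  have FI : \forall h \near 0^'-, r + h \in `]u, r[.
    apply: near_at_left0; near=> h; rewrite -mulN1r; apply: ray.
    rewrite in_itv/=; apply/andP.
    by split; near: h; [exact: nbhs_right_gt|exact: nbhs_right_lt].
  have flat M : exists C, \forall h \near 0^'-, 0 <= p (r + h) <= C * `|h| ^+ M.
    have Sphi : 0 < side_sign a b r (-1) * phir by rewrite S1 oppr_gt0.
    have [C pC] := weight_flat n_gt0 a_neq0 b_neq0 a_root a_zf p0_in sE T0 ray
      m2 Sphi M.
    exists C; apply: near_at_left0; near=> h.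
    rewrite normrN gtr0_norm; last by near: h; exact: nbhs_right_gt.
    by rewrite -mulN1r; near: h.
  have [d0 dI dr] := weight_side_smooth a_neq0 a_zf p0_in r_notin _
    (@at_left_dnbhs R) FI flat.
  split=> //; exists (r - u) => // k; split; first exact: dr.
  by move=> x; rewrite subKr; exact: dI.
- move=> m1; rewrite pP qP.
  exact: (logarithmic_integrableP n_gt0 a_neq0 b_neq0 a_root a_zf p0_in sE T0
    ray r_notin m1).
- rewrite qP.
  exact: (logarithmic_model_integrableP n a b p0_in sE T0 ray r_notin).
Unshelve. all: by end_near. Qed.

End both_sides.

Theorem proposition3p2 (R : realType) (n : nat) (a b : {poly R}) (r : R)
    (hn : (1 <= n)%N)
    (ha0 : a != 0) (ha : (size a <= n.+1)%N)
    (hb0 : b != 0) (hb : (size b <= n)%N)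
    (hr : root a r) :
  let alpha : int := (mup r a)%:Z in
  let beta : int := (mup r b)%:Z in
  let phir : R := phi a b r r in
  let q : R -> R := fun x =>
    (`|x - r| `^ (2 / n%:R * phir)) / `|x - r| ^+ mup r a in
  [/\ forall x : R, a.[x] != 0 ->
        b.[x] / a.[x] = (x - r) ^ (beta - alpha) * phi a b r x,
      ((x - r) ^ (alpha - beta) * (b.[x] / a.[x])) @[x --> r^'] --> phir
    & phir != 0]
  /\
  (ordinary_root a b r ->
    (forall u p0 : R, zero_free a r u -> p0 \in `]r, u[ ->
      let p := weight n a b p0 in
      (integrable_from_right p r u <-> (2 <= alpha - beta) /\ 0 < phir) /\
      (integrable_from_right p r u ->
         right_smooth (set_zero_at p r) r /\
         forall k : nat, right_derive_n k (set_zero_at p r) r = 0))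
    /\
    (forall u p0 : R, zero_free a u r -> p0 \in `]u, r[ ->
      let p := weight n a b p0 in
      (integrable_from_left p r u <->
         (2 <= alpha - beta) /\ (-1) ^ (alpha - beta) * phir < 0) /\
      (integrable_from_left p r u ->
         left_smooth (set_zero_at p r) r /\
         forall k : nat, left_derive_n k (set_zero_at p r) r = 0)))
  /\
  (logarithmic_root a b r ->
    (forall u p0 : R, zero_free a r u -> p0 \in `]r, u[ ->
      let p := weight n a b p0 in
      (integrable_from_right p r u <-> integrable_from_right q r u) /\
      (integrable_from_right q r u <-> 0 < 2 / n%:R * phir - alpha%:~R + 1))
    /\
    (forall u p0 : R, zero_free a u r -> p0 \in `]u, r[ ->
      let p := weight n a b p0 in
      (integrable_from_left p r u <-> integrable_from_left q r u) /\
      (integrable_from_left q r u <-> 0 < 2 / n%:R * phir - alpha%:~R + 1))).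
Proof.
move=> alpha beta phir q.
have n_gt0 : (0 < n)%N by [].
have q_model : q = power_model n a b r by [].
split.
  have ratioE x : a.[x] != 0 ->
      b.[x] / a.[x] = (x - r) ^ (beta - alpha) * phi a b r x.
    move=> ax; apply: ratio_phiE => //.
    by apply: contraNneq ax => ->.
  split=> //; last exact: phi_neq0.
  have phi_cvg : phi a b r x @[x --> r^'] --> phir.
    by apply: cvg_within_filter; exact: phi_continuous.
  apply: cvg_trans phi_cvg; apply: near_eq_cvg; near=> x.
  have xr : x != r by near: x; exists 1 => /=.
  rewrite (ratio_phiE ha0 hb0 xr) mulrA -expfzDr ?subr_eq0//.
  by rewrite addrA subrK subrr expr0z mul1r.
split=> [[_ m_ord]|[_ m_log]].
  have m1 : alpha - beta != 1 by apply/eqP => m1; apply: m_ord; lia.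
  split=> u p0 a_zf p0_in p.
    have [ordP smooth _ _] := right_side n_gt0 ha0 hb0 hr a_zf p0_in.
    have iffP := ordP m1; split=> // /iffP[m2 phi0]; exact: smooth.
  have [ordP smooth _ _] := left_side n_gt0 ha0 hb0 hr a_zf p0_in.
  have iffP := ordP m1; split=> // /iffP[m2 phi0]; exact: smooth.
have m1 : alpha - beta = 1 by lia.
split=> u p0 a_zf p0_in p.
  have [_ _ logP qP] := right_side n_gt0 ha0 hb0 hr a_zf p0_in.
  by split; [exact: logP|exact: qP].
have [_ _ logP qP] := left_side n_gt0 ha0 hb0 hr a_zf p0_in.
by split; [exact: logP|exact: qP].
Unshelve. all: by end_near. Qed.
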